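(* Let $\Bbbk$ be a perfect field of characteristic $p>0$, let $R=\Bbbk[x_1,\dots,x_n]$, and let $I=(f_1,\dots,f_r)\subseteq R$ be a nonzero equidimensional ideal of height $c$. Let $S=R[u_{ij}\mid 1\le i\le c,\ 1\le j\le r]$ be the polynomial ring over $R$ in $cr$ new variables, let $g_i=u_{i1}f_1+\cdots+u_{ir}f_r$ for $1\le i\le c$, let $L=(g_1,\dots,g_c)\subseteq S$, and let $J=(L:_S IS)$ be the generic linkage of $I$. Then $$\operatorname{lce}_R(I^c)=\operatorname{lce}_S(L^c)\le \operatorname{lce}_S(J^c),$$ where $\operatorname{lce}$ denotes the least critical exponent.
   Context: An ideal is equidimensional if it is proper and all its minimal primes have the same height. The generic linkage $J$ is formed with respect to the chosen generators $f_1,\dots,f_r$ of $I$. Frobenius powers. Let $T$ be a polynomial ring in finitely many variables over a perfect field of characteristic $p>0$, and let $\mathfrak a\subseteq T$ be an ideal. - For an integer $e\ge 0$, $\mathfrak a^{[p^e]}$ is the ideal generated by $\{f^{p^e}: f\in\mathfrak a\}$, and $\mathfrak a^{[1/p^e]}$ is the smallest ideal $\mathfrak b$ of $T$ such that $\mathfrak a\subseteq \mathfrak b^{[p^e]}$. - For an integer $k\ge 0$ with base $p$ expansion $k=k_0+k_1p+\cdots+k_mp^m$ ($0\le k_i\le p-1$), set $\mathfrak a^{[k]}=\mathfrak a^{k_0}\,(\mathfrak a^{k_1})^{[p]}\cdots(\mathfrak a^{k_m})^{[p^m]}$. - For integers $k,e\ge 0$, set $\mathfrak a^{[k/p^e]}=(\mathfrak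 a^{[k]})^{[1/p^e]}$. - For real $t\ge 0$, set $\mathfrak a^{[t]}=\bigcup_{k\ge 0}\mathfrak a^{[t_k]}$ with $t_k=\lceil tp^k\rceil/p^k$ (an increasing union, so $\mathfrak a^{[t]}=\mathfrak a^{[t_k]}$ for $k$ large). The least critical exponent of $\mathfrak a$ is $\operatorname{lce}_T(\mathfrak a)=\sup\{t\in\mathbb R_{>0}: \mathfrak a^{[t]}=T\}=\min\{t\in\mathbb R_{>0}:\mathfrak a^{[t]}\ne T\}$. *)

(* Defs.v *)
From HB Require Import structures.
From mathcomp Require Import all_boot all_order all_algebra.
From mathcomp Require Import classical_sets reals mpoly.

Set Implicit Arguments.
Unset Strict Implicit.
Unset Printing Implicit Defensive.

Import Order.TTheory GRing.Theory Num.Theory.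
Local Open Scope classical_set_scope.
Local Open Scope ring_scope.

(* In characteristic p, perfect means that the Frobenius map, which is
   automatically injective, is surjective. *)
Definition perfect_of_char (k : fieldType) (p : nat) : Prop :=
  p \in [pchar k] /\ forall x : k, exists y : k, y ^+ p = x.

Section Ideals.
Variable T : comNzRingType.
Implicit Types (I J P Q A : set T).

(* The unit ideal [setT] is allowed, unlike in [idealr_closed] of
   ring_quotient. *)
Definition is_ideal I : Prop :=
  [/\ I 0, forall x y, I x -> I y -> I (x + y)
    & forall a x, I x -> I (a * x)].

Definition ideal_gen A : set T := smallest is_ideal A.

Definition ideal_mul I J : set T := ideal_gen [set x * y | x in I & y in J].

Definition ideal_pow I (m : nat) : set T := iter m (ideal_mul I) setT.

Definition ideal_colon I J : set T := [set x | forall y, J y -> I (x * y)].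

Definition prime_ideal P : Prop :=
  [/\ is_ideal P, ~ P 1 & forall x y, P (x * y) -> P x \/ P y].

Definition minimal_prime I P : Prop :=
  [/\ prime_ideal P, I `<=` P
    & forall Q, prime_ideal Q -> I `<=` Q -> Q `<=` P -> Q = P].

Definition prime_chain P (h : nat) : Prop :=
  exists Q : nat -> set T,
    [/\ forall i, (i <= h)%N -> prime_ideal (Q i),
        forall i, (i < h)%N -> Q i `<` Q i.+1
      & Q h = P].

Definition prime_height P (h : nat) : Prop :=
  prime_chain P h /\ forall m, prime_chain P m -> (m <= h)%N.

(* Least height of a prime containing I; primes of infinite height have no
   [prime_height] and do not affect the minimum. *)
Definition ideal_height I (h : nat) : Prop :=
  (exists P, [/\ prime_ideal P, I `<=` P & prime_height P h]) /\
  (forall P m, prime_ideal P -> I `<=` P -> prime_height P m -> (h <= m)%N).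

Definition equidimensional I : Prop :=
  ~ I 1 /\
  forall P Q, minimal_prime I P -> minimal_prime I Q ->
    forall h, prime_height P h <-> prime_height Q h.

Section Frobenius.
Variable p : nat.

(* I^[p^e] *)
Definition frob_pow I (e : nat) : set T :=
  ideal_gen [set x ^+ (p ^ e)%N | x in I].

(* I^[1/p^e]. Over a polynomial ring in finitely many variables over a perfect
   field of characteristic p, which is free of finite rank over its p^e-th
   powers, the intersection itself belongs to the family, so that it is the
   smallest b with I contained in b^[p^e]. *)
Definition frob_root I (e : nat) : set T :=
  \bigcap_(b in [set b | is_ideal b /\ I `<=` frob_pow b e]) b.

(* I^[m]: the base p digits of m are (m %/ p ^ i) %% p for
   i <= trunc_log p m. *)
Definition frob_nat I (m : nat) : set T :=
  \big[ideal_mul/setT]_(i < (trunc_log p m).+1)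
     frob_pow (ideal_pow I ((m %/ p ^ i) %% p)%N) i.

(* I^[m/p^e] *)
Definition frob_frac I (m e : nat) : set T := frob_root (frob_nat I m) e.

Variable R : realType.

(* I^[t] for t >= 0; the ceiling is then nonnegative, so that taking its
   absolute value only casts it to nat. *)
Definition frob_real I (t : R) : set T :=
  \bigcup_(e : nat) frob_frac I `|Num.ceil (t * (p ^ e)%:R)|%N e.

(* The supremum is genuine for a nonzero proper ideal of a polynomial ring;
   [sup] returns 0 on a set that is empty or unbounded above. *)
Definition lce I : R := sup [set t : R | 0 < t /\ frob_real I t = setT].

End Frobenius.
End Ideals.

Section GenericLinkage.
Variables (k : fieldType) (n r : nat) (f : 'I_r -> {mpoly k[n]}) (c : nat).

Local Notation S := {mpoly {mpoly k[n]}[c * r]}.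

(* The variable u_ij is 'X_(mxvec_index i j). *)
Definition generic_comb (i : 'I_c) : S :=
  \sum_(j < r) 'X_(mxvec_index i j) * (f j)%:MP.

Definition generic_ci : set S := ideal_gen (range generic_comb).

Definition extended_ideal : set S :=
  ideal_gen [set x%:MP | x in ideal_gen (range f)].

Definition generic_linkage : set S := ideal_colon generic_ci extended_ideal.

End GenericLinkage.

Arguments generic_ci {k n r} f c.
Arguments generic_linkage {k n r} f c.

(* Main.v *)
Require Import Defs.
From mathcomp Require Import all_boot all_order all_algebra.
From mathcomp Require Import boolp classical_sets reals mpoly ring.

Set Implicit Arguments.
Unset Strict Implicit.
Unset Printing Implicit Defensive.

Import Order.TTheory GRing.Theory Num.Theory.
Local Open Scope classical_set_scope.
Local Open Scope ring_scope.

(** Write [A] for the polynomial ring of [I], [S] for [A] with the variables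
[u_ij] adjoined, [L] for the ideal of the [g_i], and [q = p^e].  By definition
[a^[m/q]] is the unit ideal exactly when no proper [b] satisfies
[a^[m] <= b^[q]] ([frob_root_eqT]).  The two exponents in the equality are
suprema of one and the same set of reals [t], because for every [m] and [e]
the ideal [(I^c)^[m/q]] is the unit ideal iff [(L^c)^[m/q]] is.

If [(I^c)^[m] <= b^[q]] with [b] proper then, as [L <= I S] and Frobenius powers
commute with extension of ideals, [(L^c)^[m] <= (b S)^[q]], and [b S] is proper
since setting all [u_ij] to 0 retracts [S] onto [A]
([generic_ci_frob_frac]).

Conversely, suppose [(L^c)^[m] <= b^[q]] with [b] proper in [S].  The element
[G = g_1 ... g_c] lies in [L^c], so [G^m] lies in [b^[q]].  Two facts finish the
argument.
- The ideal of [A] generated by the coefficients of [G^m] (as a polynomial in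
  the [u_ij]) contains [(I^c)^[m]] ([frob_nat_sub_content_prod]).  For an exponent
  [d < p], differentiating [prod_i g_i^d_i] with respect to [u_ij] multiplies by
  [d_i f_j] and lowers [d_i] by one; the integer [d_i] is invertible, so by
  induction the coefficients of [G^d] generate at least [I^(c d)].  In general
  [G^m = G^(m mod p) (G^(m div p))^p], and since the [u]-exponents of the first
  factor are less than [p], no two products of coefficients of the two factors
  collect in the same monomial, which is the recursion defining [(I^c)^[m]].
- When [m < q], every [u]-exponent in [G^m] is less than [q].  The coefficient
  field being perfect, [S] is free over its [q]-th powers on the monomials in
  all variables with exponents less than [q]; the coordinate functions, followed
  by extraction of [q]-th roots, are additive maps sending [b^[q]] into [b].
  Applied to [G^m] they show that each of its coefficients lies in [b'^[q]],
  where [b'] is the contraction of [b] to [A] ([frob_pow_contraction]).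
So [(I^c)^[m] <= b'^[q]] with [b'] proper.  The restriction [m < q] is harmless:
[I^c] is proper, because [I] is and [c > 0], and [a^[m] <= a^[q]] as soon as
[m >= q] ([frob_frac_eqT_lt]).

For the inequality, [L <= J], and [J] is proper: if [1] were in [J], then
[I S <= L], which setting all [u_ij] to 0 turns into [I = 0].  A proper ideal has
exponents bounded by 1, so the supremum is monotone there ([lce_le]). *)

(** * Ideal arithmetic *)

Section IdealArithmetic.
Variable T : comNzRingType.
Implicit Types (A B I J K : set T) (x y z : T).

Lemma ideal_genP A : is_ideal (ideal_gen A).
Proof.
split=> [K [[K0 _ _] _] //|x y Ax Ay K AK|a x Ax K AK].
  by have [_ KD _] := AK.1; apply: KD; [exact: Ax | exact: Ay].
by have [_ _ KM] := AK.1; apply: KM; exact: Ax.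
Qed.

Lemma ideal_gen_sub A K : is_ideal K -> A `<=` K -> ideal_gen A `<=` K.
Proof. exact: smallest_sub. Qed.

Lemma mem_ideal_gen A x : A x -> ideal_gen A x.
Proof. exact: sub_gen_smallest. Qed.

Lemma is_ideal_setT : is_ideal (@setT T).
Proof. by []. Qed.

Lemma ideal_eq_setT I : is_ideal I -> I 1 -> I = setT.
Proof.
move=> [_ _ IM] I1; apply/seteqP; split=> // x _.
by rewrite -[x]mulr1; apply: IM.
Qed.

Lemma ideal_mulr I x y : is_ideal I -> I x -> I (x * y).
Proof. by move=> [_ _ IM] Ix; rewrite mulrC; apply: IM. Qed.

Lemma ideal_sum I (X : Type) (s : seq X) (P : pred X) (F : X -> T) :
  is_ideal I -> (forall i, P i -> I (F i)) -> I (\sum_(i <- s | P i) F i).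
Proof. by move=> [I0 ID _] IF; apply: (big_ind I). Qed.

Lemma ideal_colonP K B : is_ideal K -> is_ideal (ideal_colon K B).
Proof.
move=> [K0 KD KM]; split=> [y _|x y Kx Ky z Bz|a x Kx z Bz].
- by rewrite mul0r.
- by rewrite mulrDl; apply: KD; [apply: Kx | apply: Ky].
- by rewrite -mulrA; apply/KM/Kx.
Qed.

Lemma ideal_mulP I J : is_ideal (ideal_mul I J).
Proof. exact: ideal_genP. Qed.

Lemma mem_ideal_mul I J x y : I x -> J y -> ideal_mul I J (x * y).
Proof. by move=> Ix Jy; apply: mem_ideal_gen; exists x => //; exists y. Qed.

Lemma ideal_mul_sub I J K : is_ideal K ->
  (forall x y, I x -> J y -> K (x * y)) -> ideal_mul I J `<=` K.
Proof.
by move=> Kid KIJ; apply: ideal_gen_sub => // _ [x Ix [y Jy <-]]; apply: KIJ.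
Qed.

Lemma ideal_mulS I J I' J' :
  I `<=` I' -> J `<=` J' -> ideal_mul I J `<=` ideal_mul I' J'.
Proof.
move=> sI sJ; apply: ideal_mul_sub (ideal_mulP _ _) _ => x y /sI Ix /sJ Jy.
exact: mem_ideal_mul.
Qed.

(** Bilinearity, obtained by passing twice to colon ideals of [K], one factor
at a time. *)
Lemma ideal_mul_gen_sub A B K : is_ideal K ->
  (forall a b, A a -> B b -> K (a * b)) ->
  ideal_mul (ideal_gen A) (ideal_gen B) `<=` K.
Proof.
move=> Kid KAB; apply: ideal_mul_sub => // x y Ax.
suff: ideal_gen B `<=` ideal_colon K (ideal_gen A).
  by move=> + By => /(_ _ By _ Ax); rewrite mulrC.
apply: ideal_gen_sub (ideal_colonP _ Kid) _ => b Bb a.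
suff sAB : ideal_gen A `<=` ideal_colon K B.
  by move=> Aa; rewrite mulrC; apply: sAB Bb.
by apply: ideal_gen_sub (ideal_colonP _ Kid) _ => a' Aa' b' Bb'; apply: KAB.
Qed.

Lemma ideal_mulA_sub I J K :
  ideal_mul (ideal_mul I J) K `<=` ideal_mul I (ideal_mul J K).
Proof.
have Pid := ideal_mulP I (ideal_mul J K).
apply: ideal_mul_sub => // x z IJx.
suff: ideal_mul I J `<=` ideal_colon (ideal_mul I (ideal_mul J K)) K by apply.
apply: ideal_mul_sub (ideal_colonP _ Pid) _ => {x z IJx} x y Ix Jy z Kz.
by rewrite -mulrA; do 2![apply: mem_ideal_mul => //].
Qed.

Lemma ideal_powP I m : is_ideal (ideal_pow I m).
Proof. by case: m => [|m]; [apply: is_ideal_setT | apply: ideal_mulP]. Qed.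

Lemma mem_ideal_pow I m x : I x -> ideal_pow I m (x ^+ m).
Proof.
by move=> Ix; elim: m => // m IHm; rewrite exprS; apply: mem_ideal_mul.
Qed.

Lemma ideal_powS I J m : I `<=` J -> ideal_pow I m `<=` ideal_pow J m.
Proof. by move=> sIJ; elim: m => // m IHm; apply: ideal_mulS. Qed.

Lemma ideal_pow_le1 I m : is_ideal I -> (0 < m)%N -> ideal_pow I m `<=` I.
Proof.
case: m => // m Iid _; apply: ideal_mul_sub => // x y Ix _.
exact: ideal_mulr.
Qed.

Lemma ideal_powD_sub I a b :
  ideal_mul (ideal_pow I a) (ideal_pow I b) `<=` ideal_pow I (a + b).
Proof.
elim: a => [|a IHa].
  apply: ideal_mul_sub (ideal_powP _ _) _ => x y _.
  by have [_ _] := ideal_powP I b; apply.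
by apply: subset_trans (@ideal_mulA_sub _ _ _) _; apply: ideal_mulS.
Qed.

Lemma ideal_powM_sub I a b :
  ideal_pow (ideal_pow I a) b `<=` ideal_pow I (a * b).
Proof.
elim: b => [|b IHb]; first by rewrite muln0.
rewrite mulnS; apply: subset_trans (@ideal_powD_sub _ _ _).
exact: ideal_mulS.
Qed.

(** Ideal products form no monoid with unit [setT] on arbitrary sets, so the
iterated product is handled by induction on the list of indices. *)
Definition ideal_prod (X : Type) (s : seq X) (F : X -> set T) :=
  \big[@ideal_mul T/setT]_(i <- s) F i.

Lemma mem_ideal_prod (X : Type) (s : seq X) (F : X -> set T) (x : X -> T) :
  (forall i, F i (x i)) -> ideal_prod s F (\prod_(i <- s) x i).
Proof.
rewrite /ideal_prod => Fx; elim: s => [|i s IHs]; first by rewrite !big_nil.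
by rewrite !big_cons; apply: mem_ideal_mul.
Qed.

Lemma ideal_prodS (X : Type) (s : seq X) (F G : X -> set T) :
  (forall i, F i `<=` G i) -> ideal_prod s F `<=` ideal_prod s G.
Proof.
rewrite /ideal_prod => sFG; elim: s => [|i s IHs]; first by rewrite !big_nil.
by rewrite !big_cons; apply: ideal_mulS.
Qed.

Lemma ideal_prod_le (X : eqType) (s : seq X) (F : X -> set T) j :
  (forall i, is_ideal (F i)) -> j \in s -> ideal_prod s F `<=` F j.
Proof.
rewrite /ideal_prod => Fid; elim: s => // i s IHs; rewrite inE big_cons.
case: eqP => [-> _|_ /= js]; apply: ideal_mul_sub => // x y Fx sy.
  exact: ideal_mulr.
by have [_ _] := Fid j; apply; apply: IHs.
Qed.

End IdealArithmetic.

(** * Frobenius powers and least critical exponents *)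

(** Only the digits below position [N] are summed, which is all of them when
[m < p ^ N]. *)
Lemma sum_base_digits p N m : (m < p ^ N)%N ->
  (\sum_(i < N) (m %/ p ^ i) %% p * p ^ i)%N = m.
Proof.
elim: N m => [|N IHN] m; first by rewrite expn0 ltnS leqn0 big_ord0 => /eqP->.
case: (posnP p) => [->|p_gt0]; first by rewrite exp0n.
rewrite expnSr => lt_m; rewrite big_ord_recl expn0 divn1 muln1.
rewrite [RHS](divn_eq m p) addnC; congr (_ + _)%N.
rewrite -[X in (X * p)%N]IHN ?ltn_divLR // big_distrl /=.
apply: eq_bigr => i _.
by rewrite /bump /= add1n expnS divnMA -mulnA [(p * _)%N]mulnC.
Qed.

Section FrobeniusPowers.
Variables (T : comNzRingType) (p : nat).
Hypothesis hp : p \in [pchar T].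
Implicit Types (A I J K : set T) (x y : T).

Let p_prime : prime p := pcharf_prime hp.

Lemma exprpD e x y : (x + y) ^+ (p ^ e) = x ^+ (p ^ e) + y ^+ (p ^ e).
Proof. by apply: exprDn_pchar; rewrite pnatX (pnatE _ p_prime) hp. Qed.

Lemma frob_powP I e : is_ideal (frob_pow p I e).
Proof. exact: ideal_genP. Qed.

Lemma mem_frob_pow I e x : I x -> frob_pow p I e (x ^+ (p ^ e)).
Proof. by move=> Ix; apply: mem_ideal_gen; exists x. Qed.

(** Additivity of Frobenius makes this an ideal, and that is why [I^[p^e]] can be
tested on the [p^e]-th powers of generators of [I]. *)
Lemma frobenius_preim_ideal K e :
  is_ideal K -> is_ideal [set x | K (x ^+ (p ^ e))].
Proof.
move=> [K0 KD KM]; split=> [|x y Kx Ky|a x Kx] /=.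
- by rewrite expr0n expn_eq0 -leqn0 leqNgt prime_gt0.
- by rewrite exprpD; apply: KD.
- by rewrite exprMn; apply: KM.
Qed.

Lemma frob_pow_gen_sub A e K : is_ideal K ->
  (forall a, A a -> K (a ^+ (p ^ e))) -> frob_pow p (ideal_gen A) e `<=` K.
Proof.
move=> Kid KA; apply: ideal_gen_sub => // _ [x Ax <-].
suff: ideal_gen A `<=` [set x | K (x ^+ (p ^ e))] by apply.
by apply: ideal_gen_sub => //; apply: frobenius_preim_ideal.
Qed.

Lemma frob_powS I J e : I `<=` J -> frob_pow p I e `<=` frob_pow p J e.
Proof.
move=> sIJ; apply: ideal_gen_sub (frob_powP _ _) _ => _ [x /sIJ Jx <-].
exact: mem_frob_pow.
Qed.

Lemma frob_pow_antitone I d e : is_ideal I -> (d <= e)%N ->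
  frob_pow p I e `<=` frob_pow p I d.
Proof.
move=> Iid le_de; apply: ideal_gen_sub (frob_powP _ _) _ => _ [x Ix <-].
rewrite -(subnK le_de) expnD exprM; apply: mem_frob_pow.
rewrite -(prednK (n := (p ^ (e - d))%N)) ?expn_gt0 ?prime_gt0 // exprS.
exact: ideal_mulr.
Qed.

Lemma frob_pow0 I : is_ideal I -> frob_pow p I 0 `<=` I.
Proof.
by move=> Iid; apply: ideal_gen_sub => // _ [x Ix <-]; rewrite expn0.
Qed.

Lemma frob_pow_succ_sub I e :
  frob_pow p I e.+1 `<=` frob_pow p (frob_pow p I e) 1.
Proof.
apply: ideal_gen_sub (frob_powP _ _) _ => _ [x Ix <-].
by rewrite expnSr exprM -[in X in _ ^+ X](expn1 p); do 2!apply: mem_frob_pow.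
Qed.

Lemma frob_pow_mul_sub I J e :
  ideal_mul (frob_pow p I e) (frob_pow p J e) `<=` frob_pow p (ideal_mul I J) e.
Proof.
apply: ideal_mul_gen_sub (frob_powP _ _) _ => _ _ [x Ix <-] [y Jy <-].
by rewrite -exprMn; apply: mem_frob_pow; apply: mem_ideal_mul.
Qed.

Lemma ideal_prod_frob_pow_sub (X : Type) (s : seq X) (F : X -> set T) e :
  ideal_prod s (fun i => frob_pow p (F i) e)
    `<=` frob_pow p (ideal_prod s F) e.
Proof.
rewrite /ideal_prod; elim: s => [|i s IHs].
  rewrite !big_nil => x _; rewrite -[x]mulr1 -(expr1n _ (p ^ e)).
  by have [_ _] := frob_powP (@setT T) e; apply; apply: mem_frob_pow.
rewrite !big_cons; apply: subset_trans _ (@frob_pow_mul_sub _ _ _).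
exact: ideal_mulS.
Qed.

(** The product of the digit factors of [I^[m]] over the first [N] digits of
    [m]; letting [N] vary makes an induction on the digits possible. *)
Definition frob_digits I m N : set T :=
  ideal_prod (index_enum 'I_N)
    (fun i => frob_pow p (ideal_pow I ((m %/ p ^ i) %% p)%N) i).

Lemma frob_natE I m : frob_nat p I m = frob_digits I m (trunc_log p m).+1.
Proof. by []. Qed.

Lemma frob_natS I J m : I `<=` J -> frob_nat p I m `<=` frob_nat p J m.
Proof.
by move=> sIJ; apply: ideal_prodS => i; exact: frob_powS (ideal_powS sIJ).
Qed.

Lemma ltn_pow_trunc_log m : (m < p ^ (trunc_log p m).+1)%N.
Proof. exact/trunc_log_ltn/prime_gt1. Qed.

Lemma mem_frob_nat I m x : I x -> frob_nat p I m (x ^+ m).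
Proof.
move=> Ix; rewrite -{2}(sum_base_digits (ltn_pow_trunc_log m)) -prodrXr.
apply: mem_ideal_prod => i.
by rewrite exprM; exact: mem_frob_pow (mem_ideal_pow _ Ix).
Qed.

(** The leading digit of [m] is nonzero and sits at a position [s >= e], so the
corresponding factor of [I^[m]] is inside [I^[p^s]]. *)
Lemma frob_nat_sub_frob_pow I m e : is_ideal I -> (p ^ e <= m)%N ->
  frob_nat p I m `<=` frob_pow p I e.
Proof.
move=> Iid le_m; set s := trunc_log p m.
have p_gt1 := prime_gt1 p_prime.
have le_es : (e <= s)%N by apply: trunc_log_max.
have m_gt0 : (0 < m)%N by apply: leq_trans le_m; rewrite expn_gt0 prime_gt0.
apply: subset_trans _ (frob_pow_antitone Iid le_es).
apply: (@subset_trans _ (frob_pow p (ideal_pow I ((m %/ p ^ s) %% p)%N) s)).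
  rewrite frob_natE.
  apply: (@ideal_prod_le _ _ _ (fun i : 'I_s.+1 =>
    frob_pow p (ideal_pow I ((m %/ p ^ i) %% p)%N) i) ord_max).
    by move=> i; apply: frob_powP.
  exact: mem_index_enum.
apply: frob_powS; apply: ideal_pow_le1 => //.
have le_s : (p ^ s <= m)%N by apply: trunc_logP.
rewrite modn_small ?divn_gt0 ?expn_gt0 ?prime_gt0 //.
by rewrite ltn_divLR ?expn_gt0 ?prime_gt0 // -expnS; apply: ltn_pow_trunc_log.
Qed.

(** Splitting off the lowest digit: [I^[m]] is inside
[I^(m mod p) (I^[m div p])^[p]]. *)
Lemma frob_digits_recl_sub I m N :
  frob_digits I m N.+1 `<=`
    ideal_mul (ideal_pow I (m %% p)) (frob_pow p (frob_digits I (m %/ p) N) 1).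
Proof.
rewrite /frob_digits /ideal_prod big_ord_recl; apply: ideal_mulS.
  by rewrite expn0 divn1; exact: frob_pow0 (ideal_powP _ _).
apply: subset_trans _ (@ideal_prod_frob_pow_sub _ _ _ _).
apply: ideal_prodS => i; rewrite /= /bump add1n expnS divnMA.
exact: frob_pow_succ_sub.
Qed.

Lemma frob_rootP I e : is_ideal (frob_root p I e).
Proof.
split=> [b [[b0 _ _] _] //|x y Ix Iy b bP|a x Ix b bP].
  by have [_ bD _] := bP.1; apply: bD; [exact: Ix | exact: Iy].
by have [_ _ bM] := bP.1; apply: bM; exact: Ix.
Qed.

(** Intersections of ideals being ideals, the root is everything iff no proper
[b] takes part in the intersection defining it. *)
Lemma frob_root_eqT I e : frob_root p I e = setT <->
  (forall b, is_ideal b -> I `<=` frob_pow p b e -> b 1).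
Proof.
split=> [rT b bid sIb|bP]; last first.
  by apply: ideal_eq_setT (frob_rootP _ _) _ => b [bid]; apply: bP.
by have: frob_root p I e 1 by [rewrite rT]; apply.
Qed.

Lemma frob_fracS I J m e : I `<=` J ->
  frob_frac p I m e = setT -> frob_frac p J m e = setT.
Proof.
move=> sIJ /frob_root_eqT rI; apply/frob_root_eqT => b bid sJb.
by apply: rI => //; apply: subset_trans sJb; apply: frob_natS.
Qed.

(** If [m >= p^e] then [I] itself belongs to the family of ideals whose
intersection is [I^[m/p^e]]. *)
Lemma frob_frac_eqT_lt I m e : is_ideal I -> ~ I 1 ->
  frob_frac p I m e = setT -> (m < p ^ e)%N.
Proof.
move=> Iid I1 /frob_root_eqT rI; rewrite ltnNge; apply/negP => le_m.
by apply: I1; apply: rI => //; apply: frob_nat_sub_frob_pow.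
Qed.

Variable R : realType.

Lemma frob_real_eqT I (t : R) : frob_real p I t = setT <->
  exists e, frob_frac p I `|Num.ceil (t * (p ^ e)%:R)|%N e = setT.
Proof.
split=> [It|[e Ie]].
  have: frob_real p I t 1 by rewrite It.
  by move=> [e _ Ie]; exists e; apply: ideal_eq_setT Ie; apply: frob_rootP.
by apply/seteqP; split=> // x _; exists e => //; rewrite Ie.
Qed.

Lemma frob_real_eqT_le1 I (t : R) : is_ideal I -> ~ I 1 -> 0 < t ->
  frob_real p I t = setT -> t <= 1.
Proof.
move=> Iid I1 t0 /frob_real_eqT[e /(frob_frac_eqT_lt Iid I1) lt_q].
have q0 : 0 < (p ^ e)%:R :> R by rewrite ltr0n expn_gt0 prime_gt0.
have tq : 0 <= t * (p ^ e)%:R by rewrite mulr_ge0 // ltW.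
have ceil0 : 0 <= Num.ceil (t * (p ^ e)%:R).
  by rewrite ceil_ge0 (lt_le_trans _ tq) // ltrN10.
rewrite -(ler_pM2r q0) mul1r (_ : (p ^ e)%:R = (p ^ e)%:Z%:~R :> R) //.
by rewrite -ceil_le_int -(gez0_abs ceil0) lez_nat ltnW.
Qed.

(** Properness of [J] bounds by 1 the set of which [lce J] is the supremum;
without a bound [sup] would be 0 and monotonicity could fail. *)
Lemma lce_le I J : is_ideal J -> ~ J 1 -> I `<=` J -> lce p R I <= lce p R J.
Proof.
move=> Jid J1 sIJ; rewrite /lce.
set X := [set t | _]; set Y := [set t | _].
have sXY : X `<=` Y.
  move=> t [t0 /frob_real_eqT[e Ie]]; split=> //.
  by apply/frob_real_eqT; exists e; apply: frob_fracS Ie.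
have Y1 : ubound Y 1.
  by move=> t [t0]; apply: frob_real_eqT_le1.
have [->|/set0P[t Xt]] := eqVneq X set0; last first.
  apply: ge_sup; first by exists t.
  by move=> s Xs; apply: ub_le_sup; [exists 1 | apply: sXY].
rewrite sup0; have [->|/set0P[t Yt]] := eqVneq Y set0; first by rewrite sup0.
by apply: le_trans (ub_le_sup _ Yt); [apply: ltW Yt.1 | exists 1].
Qed.

End FrobeniusPowers.

(** * Extension of ideals along a ring homomorphism *)

Section Extension.
Variables (T U : comNzRingType) (phi : {rmorphism T -> U}) (p : nat).
Hypothesis hp : p \in [pchar T].
Implicit Types (I J K : set T).

Let hpU : p \in [pchar U] := rmorph_pchar phi hp.

Definition ideal_ext I : set U := ideal_gen [set phi x | x in I].

Lemma mem_ideal_ext I x : I x -> ideal_ext I (phi x).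
Proof. by move=> Ix; apply: mem_ideal_gen; exists x. Qed.

Lemma ideal_extS I J : I `<=` J -> ideal_ext I `<=` ideal_ext J.
Proof.
move=> sIJ; apply: ideal_gen_sub (ideal_genP _) _ => _ [x /sIJ Jx <-].
exact: mem_ideal_ext.
Qed.

Lemma preim_ideal (K : set U) : is_ideal K -> is_ideal [set x | K (phi x)].
Proof.
move=> [K0 KD KM]; split=> [|x y Kx Ky|a x Kx] /=.
- by rewrite rmorph0.
- by rewrite rmorphD; apply: KD.
- by rewrite rmorphM; apply: KM.
Qed.

Lemma ideal_ext_mul_sub I J :
  ideal_mul (ideal_ext I) (ideal_ext J) `<=` ideal_ext (ideal_mul I J).
Proof.
apply: ideal_mul_gen_sub (ideal_genP _) _ => _ _ [x Ix <-] [y Jy <-].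
by rewrite -rmorphM; apply: mem_ideal_ext; apply: mem_ideal_mul.
Qed.

Lemma ideal_ext_setT y : ideal_ext setT y.
Proof.
have [_ _ /(_ y 1)] := ideal_genP [set phi x | x in setT].
by rewrite mulr1; apply; rewrite -(rmorph1 phi); apply: mem_ideal_ext.
Qed.

Lemma ideal_ext_pow_sub I m :
  ideal_pow (ideal_ext I) m `<=` ideal_ext (ideal_pow I m).
Proof.
elim: m => [|m IHm] x; first by move=> _; apply: ideal_ext_setT.
move=> Ix; apply: ideal_ext_mul_sub; move: x Ix.
exact: ideal_mulS.
Qed.

Lemma ideal_ext_prod_sub (X : Type) (s : seq X) (F : X -> set T) :
  ideal_prod s (fun i => ideal_ext (F i)) `<=` ideal_ext (ideal_prod s F).
Proof.
rewrite /ideal_prod; elim: s => [|i s IHs].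
  by rewrite !big_nil => x _; apply: ideal_ext_setT.
rewrite !big_cons; apply: subset_trans _ (@ideal_ext_mul_sub _ _).
exact: ideal_mulS.
Qed.

Lemma frob_pow_ext_sub I e :
  frob_pow p (ideal_ext I) e `<=` ideal_ext (frob_pow p I e).
Proof.
apply: frob_pow_gen_sub (ideal_genP _) _ => // _ [x Ix <-].
by rewrite -rmorphXn; apply: mem_ideal_ext; apply: mem_frob_pow.
Qed.

Lemma ideal_ext_frob_pow_sub I e :
  ideal_ext (frob_pow p I e) `<=` frob_pow p (ideal_ext I) e.
Proof.
apply: ideal_gen_sub (frob_powP _ _ _) _ => _ [x Ix <-].
suff: frob_pow p I e `<=` [set x | frob_pow p (ideal_ext I) e (phi x)] by apply.
apply: ideal_gen_sub => [|_ [y Iy <-] /=].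
  exact/preim_ideal/frob_powP.
by rewrite rmorphXn; apply: mem_frob_pow; apply: mem_ideal_ext.
Qed.

Lemma frob_nat_ext_sub I m :
  frob_nat p (ideal_ext I) m `<=` ideal_ext (frob_nat p I m).
Proof.
rewrite !frob_natE; apply: subset_trans _ (@ideal_ext_prod_sub _ _ _).
apply: ideal_prodS => i; apply: subset_trans _ (@frob_pow_ext_sub _ _).
exact: frob_powS (@ideal_ext_pow_sub _ _).
Qed.

Lemma ideal_ext_retract (rho : {rmorphism U -> T}) I :
  cancel phi rho -> is_ideal I -> ideal_ext I 1 -> I 1.
Proof.
move=> phiK [I0 ID IM] I1.
suff: ideal_ext I `<=` [set y | I (rho y)].
  by move=> /(_ _ I1) /=; rewrite rmorph1.
apply: ideal_gen_sub => [|_ [x Ix <-] /=]; last by rewrite phiK.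
split=> [|x y Ix Iy|a x Ix] /=.
- by rewrite rmorph0.
- by rewrite rmorphD; apply: ID.
- by rewrite rmorphM; apply: IM.
Qed.

(** A proper [b] with [I^[m] <= b^[p^e]] extends to an ideal of [U] with the same
property for the extension of [I], and a retraction keeps it proper. *)
Lemma frob_frac_ext_eqT (rho : {rmorphism U -> T}) I m e : cancel phi rho ->
  frob_frac p (ideal_ext I) m e = setT -> frob_frac p I m e = setT.
Proof.
move=> phiK /frob_root_eqT rU; apply/frob_root_eqT => b bid sIb.
apply: (ideal_ext_retract phiK bid); apply: rU; first exact: ideal_genP.
apply: subset_trans (@frob_nat_ext_sub _ _) _.
exact: subset_trans (ideal_extS sIb) (@ideal_ext_frob_pow_sub _ _).
Qed.

End Extension.

(** * Cartier maps on polynomial rings *)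

(** These are the [p^-e]-linear maps for [q = p^e]; on a polynomial ring over
a perfect field they detect membership in [b^[p^e]]. *)
Definition cartier_map (T : comNzRingType) (q : nat) (kappa : T -> T) : Prop :=
  {morph kappa : x y / x + y} /\
  forall x y, kappa (x ^+ q * y) = x * kappa y.

Lemma cartier_map0 (T : comNzRingType) q (kappa : T -> T) :
  cartier_map q kappa -> kappa 0 = 0.
Proof. by move=> [kD _]; apply: (addIr (kappa 0)); rewrite -kD !add0r. Qed.

Lemma cartier_map_frob_pow (T : comNzRingType) p e (kappa : T -> T) b y :
  cartier_map (p ^ e) kappa -> is_ideal b -> frob_pow p b e y -> b (kappa y).
Proof.
move=> kC [b0 bD bM] by_; have [kD kM] := kC; rewrite -[y]mul1r; move: (1 : T).
suff: frob_pow p b e `<=` [set y | forall a, b (kappa (a * y))] by apply.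
apply: ideal_gen_sub => [|_ [x bx <-] a /=]; last first.
  by rewrite mulrC kM mulrC; apply: bM.
split=> [a|x1 x2 b1 b2 a|c x bx a] /=.
- by rewrite mulr0 (cartier_map0 kC).
- by rewrite mulrDr kD; apply: bD.
- by rewrite mulrA; apply: bx.
Qed.

Section MonomialDivision.
Variables (n q : nat).
Implicit Types (m gamma : 'X_{1..n}) (alpha : {ffun 'I_n -> 'I_q}).

Definition mnm_quo m : 'X_{1..n} := [multinom (m i %/ q)%N | i < n].

Definition mnm_digit alpha : 'X_{1..n} := [multinom (alpha i : nat) | i < n].

Definition mnm_has_rem m alpha := [forall i, (m i %% q == alpha i)%N].

Lemma mnm_digitE alpha i : mnm_digit alpha i = alpha i.
Proof. exact: mnmE. Qed.

(** Euclidean division by [q] in each coordinate, with the remainder encoded as a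
function into ['I_q] so that the remainders form a finite type. *)
Lemma eq_mnm_divE m gamma alpha :
  (m == gamma *+ q + mnm_digit alpha)%MM
    = mnm_has_rem m alpha && (mnm_quo m == gamma).
Proof.
apply/eqP/andP => [->|[/forallP rm /eqP <-]].
  split; [apply/forallP => i | apply/eqP/mnmP => i].
    by rewrite mnmDE mulmnE mnm_digitE modnMDl modn_small.
  have q_gt0 : (0 < q)%N by case: (q) (alpha i) => [[]|].
  by rewrite mnmE mnmDE mulmnE mnm_digitE divnMDl // divn_small ?addn0.
apply/mnmP => i; rewrite mnmDE mulmnE mnm_digitE mnmE -(eqP (rm i)).
exact: divn_eq.
Qed.

Lemma mnm_quoMD m m' : (0 < q)%N -> mnm_quo (m *+ q + m') = (m + mnm_quo m')%MM.
Proof.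
by move=> q0; apply/mnmP => i; rewrite mnmE !mnmDE mulmnE mnmE divnMDl.
Qed.

Lemma mnm_has_remMD m m' alpha :
  mnm_has_rem (m *+ q + m') alpha = mnm_has_rem m' alpha.
Proof. by apply: eq_forallb => i; rewrite mnmDE mulmnE modnMDl. Qed.

End MonomialDivision.

Section MpolyFrobenius.
Variables (A : comNzRingType) (n p : nat).
Hypothesis hp : p \in [pchar A].
Implicit Types (x y : {mpoly A[n]}).

Lemma pchar_mpoly : p \in [pchar {mpoly A[n]}].
Proof. exact: (rmorph_pchar (mpolyC n (R:=A)) hp). Qed.

(** Frobenius acts on a polynomial coefficientwise and monomialwise. *)
Lemma mpoly_frobE e x :
  x ^+ (p ^ e)
    = \sum_(m <- msupp x) x@_m ^+ (p ^ e) *: 'X_[(m *+ (p ^ e))%MM].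
Proof.
rewrite {1}[x]mpolyE.
have := big_morph (fun x : {mpoly A[n]} => x ^+ (p ^ e)) (exprpD pchar_mpoly e).
move=> /(_ 0 0) ->; first by apply: eq_bigr => m _; rewrite exprZn mpolyXn.
by rewrite expr0n gtn_eqF // expn_gt0 prime_gt0 ?(pcharf_prime hp).
Qed.

End MpolyFrobenius.

Lemma sum_msupp_pred1 (A : nzRingType) n (x : {mpoly A[n]})
    (F : 'X_{1..n} -> A) a :
  (x@_a = 0 -> F a = 0) -> \sum_(m <- msupp x) F m * (m == a)%:R = F a.
Proof.
move=> F0; have [ax|ax] := boolP (a \in msupp x).
  rewrite (bigD1_seq a) ?msupp_uniq //= eqxx mulr1 big1 ?addr0 // => m.
  by move=> /negPf ->; rewrite mulr0.
rewrite F0 ?memN_msupp_eq0 // big1_seq // => m /andP[_ mx].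
by case: eqP mx ax => [->|_ _ _]; [move=> -> | rewrite mulr0].
Qed.

Section MpolyCartier.
Variables (A : comNzRingType) (n p e : nat).
Hypothesis hp : p \in [pchar A].
Let q := (p ^ e)%N.
Variable kappa : A -> A.
Hypothesis kappaC : cartier_map q kappa.
Implicit Types (x y : {mpoly A[n]}) (alpha : {ffun 'I_n -> 'I_q}).

Let q_gt0 : (0 < q)%N.
Proof. by rewrite expn_gt0 prime_gt0 ?(pcharf_prime hp). Qed.

(** The [alpha]-coordinate of [x] on the monomials with exponents less than [q],
with [kappa] applied to coefficients and exponents divided by [q]. *)
Definition mpoly_cartier alpha x : {mpoly A[n]} :=
  \sum_(m <- msupp x | mnm_has_rem m alpha) kappa x@_m *: 'X_[mnm_quo q m].

Lemma mcoeff_cartier alpha x gamma :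
  (mpoly_cartier alpha x)@_gamma
    = kappa x@_(gamma *+ q + mnm_digit alpha)%MM.
Proof.
rewrite /mpoly_cartier raddf_sum /= big_mkcond /=.
rewrite -(sum_msupp_pred1 (x := x) (F := fun m => kappa x@_m)); last first.
  by move=> ->; apply: cartier_map0 kappaC.
apply: eq_bigr => m _; rewrite mcoeffZ mcoeffX eq_mnm_divE.
by case: ifP; rewrite ?mulr0.
Qed.

Lemma mpoly_cartierD alpha : {morph mpoly_cartier alpha : x y / x + y}.
Proof.
move=> x y; apply/mpolyP => gamma.
by rewrite mcoeffD !mcoeff_cartier mcoeffD; apply: kappaC.1.
Qed.

Lemma mpoly_cartier0 alpha : mpoly_cartier alpha 0 = 0.
Proof.
apply/mpolyP => gamma; rewrite mcoeff_cartier !mcoeff0.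
exact: cartier_map0 kappaC.
Qed.

Lemma mpoly_cartierX alpha c m :
  mpoly_cartier alpha (c *: 'X_[m])
    = if mnm_has_rem m alpha then kappa c *: 'X_[mnm_quo q m] else 0.
Proof.
apply/mpolyP => gamma; rewrite mcoeff_cartier mcoeffZ mcoeffX eq_mnm_divE.
case: ifP => _ /=; last by rewrite mulr0 mcoeff0 (cartier_map0 kappaC).
rewrite mcoeffZ mcoeffX.
by case: eqP => _; rewrite ?mulr1 // !mulr0 (cartier_map0 kappaC).
Qed.

(** By additivity in both arguments it suffices to consider monomials, where
multiplying by [('X_[m])^q] leaves remainders unchanged and adds [m] to
the quotient. *)
Lemma mpoly_cartierP alpha : cartier_map q (mpoly_cartier alpha).
Proof.
split=> [|x y]; first exact: mpoly_cartierD.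
rewrite /q (mpoly_frobE hp) -/q {3}[x]mpolyE !mulr_suml.
rewrite (big_morph _ (@mpoly_cartierD alpha) (mpoly_cartier0 alpha)).
apply: eq_bigr => m _; rewrite {1 2}[y]mpolyE mulr_sumr.
rewrite !(big_morph _ (@mpoly_cartierD alpha) (mpoly_cartier0 alpha)) mulr_sumr.
apply: eq_bigr => m' _.
rewrite -scalerAl -scalerAr scalerA -mpolyXD !mpoly_cartierX.
rewrite mnm_has_remMD mnm_quoMD //; case: ifP => _; last by rewrite mulr0.
by rewrite kappaC.2 -scalerAl -scalerAr scalerA -mpolyXD.
Qed.

(** When all exponents are less than [q], only the zero quotient occurs. *)
Lemma mpoly_cartier_small alpha x :
  (forall m i, m \in msupp x -> (m i < q)%N) ->
  mpoly_cartier alpha x = (kappa x@_(mnm_digit alpha))%:MP.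
Proof.
move=> small; apply/mpolyP => gamma; rewrite mcoeff_cartier mcoeffC.
have [->|gamma0] := eqVneq gamma 0%MM.
  rewrite mulr1; congr (kappa x@__); apply/mnmP => i.
  by rewrite mnmDE mulmnE mnm0E.
rewrite mulr0 memN_msupp_eq0 ?(cartier_map0 kappaC) //.
apply/negP => /small sx; case/negP: gamma0; apply/eqP/mnmP => i.
move: (sx i); rewrite mnmDE mulmnE mnm0E; case: (gamma i) => // j.
by rewrite mulSn -addnA ltnNge leq_addr.
Qed.

(** If [kappa] extracts [q]-th roots, the Cartier maps are the coordinates of
the expansion over [q]-th powers; both sides are additive in [x], so this is
again a computation on monomials. *)
Lemma mpoly_cartier_sum (kappaK : forall a, kappa a ^+ q = a) x :
  x = \sum_alpha mpoly_cartier alpha x ^+ q * 'X_[mnm_digit alpha].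
Proof.
have hpx := @pchar_mpoly A n p hp.
have exp0q : 0 ^+ q = 0 :> {mpoly A[n]} by rewrite expr0n gtn_eqF.
pose S x := \sum_alpha mpoly_cartier alpha x ^+ q * 'X_[mnm_digit alpha].
have SD : {morph S : x y / x + y}.
  move=> y z; rewrite -big_split; apply: eq_bigr => alpha _ /=.
  by rewrite mpoly_cartierD (exprpD hpx) mulrDl.
have S0 : S 0 = 0.
  by rewrite /S big1 // => alpha _; rewrite mpoly_cartier0 exp0q mul0r.
rewrite -/(S x) {2}[x]mpolyE (big_morph S SD S0) {1}[x]mpolyE.
apply: eq_bigr => m _.
pose alpha : {ffun 'I_n -> 'I_q} := [ffun i => Ordinal (ltn_pmod (m i) q_gt0)].
have rem_alpha : mnm_has_rem m alpha by apply/forallP => i; rewrite ffunE.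
rewrite /S (bigD1 alpha) //= big1 ?addr0 => [|beta neq_ab]; last first.
  rewrite mpoly_cartierX ifN ?exp0q ?mul0r //.
  apply: contra neq_ab => /forallP rem_beta; apply/eqP/ffunP => i.
  by apply/val_inj; rewrite /= -(eqP (rem_beta i)) ffunE.
rewrite mpoly_cartierX rem_alpha exprZn kappaK mpolyXn -scalerAl -mpolyXD.
congr (_ *: 'X_[_]); apply/eqP.
by rewrite eq_mnm_divE rem_alpha eqxx.
Qed.

End MpolyCartier.

(** Frobenius of a perfect field is bijective, and its inverse is the Cartier
map from which those of polynomial rings are built. *)
Lemma perfect_root (k : fieldType) p e : perfect_of_char k p ->
  exists2 kappa : k -> k,
    cartier_map (p ^ e) kappa & forall a, kappa a ^+ (p ^ e) = a.
Proof.
move=> [hp surj].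
have surj_e (a : k) : exists b, b ^+ (p ^ e) = a.
  elim: e a => [|e IHe] a; first by exists a; rewrite expn0.
  have [b <-] := surj a; have [c <-] := IHe b.
  by exists c; rewrite expnSr exprM.
have [kappa kappaK] := choice surj_e.
have inj : injective (fun a : k => a ^+ (p ^ e)).
  move=> a b /= ab; have := exprpD hp e (a - b) b; rewrite subrK ab.
  move=> /eqP; rewrite -subr_eq subrr eq_sym expf_eq0 subr_eq0.
  by case/andP=> _ /eqP.
exists kappa => //; split=> a b; apply: inj => /=.
  by rewrite (exprpD hp) !kappaK.
by rewrite exprMn !kappaK.
Qed.

(** * Coefficient ideals of polynomials *)

Section Content.
Variables (A : comNzRingType) (n : nat).
Implicit Types (x y : {mpoly A[n]}) (I K : set A).

Definition content (x : {mpoly A[n]}) : set A :=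
  ideal_gen (range (fun m => x@_m)).

Lemma contentP x : is_ideal (content x).
Proof. exact: ideal_genP. Qed.

Lemma mem_content x m : content x x@_m.
Proof. by apply: mem_ideal_gen; exists m. Qed.

Lemma content_sub x K : is_ideal K -> (forall m, K x@_m) -> content x `<=` K.
Proof. by move=> Kid Kx; apply: ideal_gen_sub => // _ [m _ <-]. Qed.

Lemma content1 : content (1 : {mpoly A[n]}) = setT.
Proof.
apply: ideal_eq_setT (contentP _) _.
by have := @mem_content 1 0%MM; rewrite mcoeff1 eqxx.
Qed.

(** Coefficients of a derivative are integer multiples of coefficients. *)
Lemma content_deriv_sub i x : content x^`M(i) `<=` content x.
Proof.
apply: content_sub (contentP _) _ => m; rewrite mcoeff_deriv -mulr_natr.
by apply: ideal_mulr (contentP _) _; apply: mem_content.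
Qed.

Lemma mem_contentZ a b x : content x b -> content (a *: x) (a * b).
Proof.
move=> xb; rewrite mulrC.
suff: content x `<=` ideal_colon (content (a *: x)) [set a] by apply.
apply: content_sub => [|m _ ->]; first exact/ideal_colonP/contentP.
by rewrite mulrC -mcoeffZ; apply: mem_content.
Qed.

Definition deg_in_le (i : 'I_n) d x := forall m, m \in msupp x -> (m i <= d)%N.

Lemma deg_in_leW i d d' x : (d <= d')%N -> deg_in_le i d x -> deg_in_le i d' x.
Proof. by move=> le_d xd m /xd /leq_trans; apply. Qed.

Lemma deg_in_leM i d d' x y :
  deg_in_le i d x -> deg_in_le i d' y -> deg_in_le i (d + d') (x * y).
Proof.
move=> xd yd m /msuppM_le /allpairsP[[m1 m2] /= [/xd m1d /yd m2d ->]].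
by rewrite mnmDE leq_add.
Qed.

Lemma deg_in_leC i c : deg_in_le i 0 c%:MP.
Proof.
move=> m; rewrite msuppC; case: ifP => // _.
by rewrite inE => /eqP->; rewrite mnm0E.
Qed.

Lemma deg_in_le_prod i (X : Type) (s : seq X) (F : X -> {mpoly A[n]}) d :
  (forall j, deg_in_le i (d j) (F j)) ->
  deg_in_le i (\sum_(j <- s) d j)%N (\prod_(j <- s) F j).
Proof.
move=> Fd; elim: s => [|j s IHs]; first by rewrite !big_nil; apply: deg_in_leC.
by rewrite !big_cons; apply: deg_in_leM.
Qed.

Lemma deg_in_le_sum i (X : Type) (s : seq X) (F : X -> {mpoly A[n]}) d :
  (forall j, deg_in_le i d (F j)) -> deg_in_le i d (\sum_(j <- s) F j).
Proof.
move=> Fd; elim: s => [|j s IHs].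
  by rewrite big_nil -mpolyC0; apply: deg_in_leW (@deg_in_leC i 0).
by rewrite big_cons => m /msuppD_le; rewrite mem_cat => /orP[/Fd|/IHs].
Qed.

Lemma deg_in_leX i x d k : deg_in_le i d x -> deg_in_le i (d * k) (x ^+ k).
Proof.
move=> xd; elim: k => [|k IHk]; first by rewrite muln0; apply: deg_in_leC.
by rewrite mulnS exprS; apply: deg_in_leM.
Qed.

Variable p : nat.
Hypothesis hp : p \in [pchar A].

(** Since the exponents of [x] are less than [p^e], a monomial of the product
determines, by Euclidean division of its exponents, the pair of monomials of
[x] and [y] that it comes from. *)
Lemma mcoeff_mul_frob e x y m m' :
  (forall i, deg_in_le i (p ^ e).-1 x) -> m \in msupp x ->
  (x * y ^+ (p ^ e))@_(m' *+ (p ^ e) + m)%MM = x@_m * y@_m' ^+ (p ^ e).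
Proof.
set q := (p ^ e)%N => xq mx.
have q_gt0 : (0 < q)%N by rewrite expn_gt0 prime_gt0 ?(pcharf_prime hp).
have ltq k : k \in msupp x -> forall i, (k i < q)%N.
  by move=> kx i; have := xq i k kx; rewrite -ltnS prednK.
pose alpha : {ffun 'I_n -> 'I_q} := [ffun i => Ordinal (ltq m mx i)].
have digit_alpha : mnm_digit alpha = m.
  by apply/mnmP => i; rewrite mnm_digitE ffunE.
rewrite /q (mpoly_frobE hp) -/q mulr_sumr raddf_sum /=.
rewrite -(sum_msupp_pred1 (x := y) (F := fun k => x@_m * y@_k ^+ q));
  last first.
  by move=> ->; rewrite expr0n gtn_eqF // mulr0.
apply: eq_bigr => k _; rewrite -scalerAr mcoeffZ mulrAC [RHS]mulrC.
congr (_ * _).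
rewrite {1}[x]mpolyE mulr_suml raddf_sum /=.
rewrite -(sum_msupp_pred1 (x := x) (F := fun l => x@_l * (k == m')%:R));
  last first.
  by move=> ->; rewrite mul0r.
apply: eq_big_seq => l lx; rewrite -scalerAl mcoeffZ -mpolyXD mcoeffX -mulrA.
congr (_ * _); rewrite -natrM mulnb addmC -[in LHS]digit_alpha eq_mnm_divE.
rewrite mnm_has_remMD mnm_quoMD // andbC; congr (_ && _)%:R.
  rewrite (_ : mnm_quo q l = 0%MM) ?addm0 //.
  by apply/mnmP => i; rewrite mnmE mnm0E divn_small ?ltq.
rewrite -[X in _ == X]digit_alpha; apply/forallP/eqP => [lm|-> i].
  by apply/mnmP => i; rewrite mnm_digitE -(eqP (lm i)) modn_small // ltq.
by rewrite mnm_digitE modn_small.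
Qed.

Lemma content_mul_frob_sub e x y : (forall i, deg_in_le i (p ^ e).-1 x) ->
  ideal_mul (content x) (frob_pow p (content y) e)
    `<=` content (x * y ^+ (p ^ e)).
Proof.
set z := x * _ => xq; have zid := contentP z.
apply: ideal_mul_sub => // a b xa.
suff: frob_pow p (content y) e `<=` ideal_colon (content z) (content x).
  by move=> + yb => /(_ _ yb a xa); rewrite mulrC.
apply: frob_pow_gen_sub (ideal_colonP _ zid) _ => // _ [m' _ <-] c xc.
rewrite mulrC.
suff: content x `<=` ideal_colon (content z) [set y@_m' ^+ (p ^ e)] by apply.
apply: content_sub (ideal_colonP _ zid) _ => m _ ->.
have [mx|/memN_msupp_eq0->] := boolP (m \in msupp x); last first.
  by rewrite mul0r; have [] := zid.
by rewrite -mcoeff_mul_frob //; apply: mem_content.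
Qed.

(** Induction on the number of digits of [m], writing
[x^m = x^(m mod p) (x^(m div p))^p]; since [x] has degree at most 1 in each
variable, the first factor has exponents less than [p]. *)
Lemma frob_nat_sub_content I x m : (forall i, deg_in_le i 1 x) ->
  (forall d, (d < p)%N -> ideal_pow I d `<=` content (x ^+ d)) ->
  frob_nat p I m `<=` content (x ^+ m).
Proof.
move=> x1 Ix; rewrite frob_natE.
have := ltn_pow_trunc_log hp m; move: (trunc_log p m).+1 => N.
have p_gt0 : (0 < p)%N by rewrite prime_gt0 ?(pcharf_prime hp).
elim: N m => [|N IHN] m.
  by rewrite expn0 ltnS leqn0 => /eqP->; rewrite expr0 content1.
rewrite expnSr -ltn_divLR // => /IHN {}IHN.
apply: subset_trans (@frob_digits_recl_sub _ p I m N) _.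
rewrite {3}(divn_eq m p) addnC exprD exprM -[in X in _ ^+ X](expn1 p).
have lt_mp : (m %% p < p)%N by rewrite ltn_mod.
have xd i : deg_in_le i (p ^ 1).-1 (x ^+ (m %% p)).
  apply: deg_in_leW (deg_in_leX (k := m %% p) (x1 i)).
  by rewrite mul1n expn1 -ltnS prednK.
apply: subset_trans _ (content_mul_frob_sub xd).
by apply: ideal_mulS (Ix _ lt_mp) _; apply: frob_powS.
Qed.

End Content.

(** * Products of generic linear combinations *)

(** The inverse is a Bezout coefficient of [d] modulo [p]. *)
Lemma natr_unit_pchar (T : comNzRingType) p d : p \in [pchar T] ->
  (0 < d < p)%N -> exists a : T, a * d%:R = 1.
Proof.
move=> hp /andP[d_gt0 lt_dp]; have p_prime := pcharf_prime hp.
have cop : coprime d p.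
  by rewrite coprime_sym prime_coprime // gtnNdvd.
have [u v def_u _] := egcdnP p d_gt0.
exists u%:R; rewrite -natrM def_u (eqP cop) natrD natrM (pcharf0 hp).
by rewrite mulr0 add0r.
Qed.

Lemma mem_ideal_pow_prod (T : comNzRingType) (I : set T) c (x : 'I_c -> T) :
  (forall i, I (x i)) -> ideal_pow I c (\prod_(i < c) x i).
Proof.
elim: c x => [|c IHc] x Ix //; rewrite big_ord_recl.
by apply: mem_ideal_mul => //; apply: IHc.
Qed.

Section GenericCombinations.
Variables (k : fieldType) (n r c p : nat) (f : 'I_r -> {mpoly k[n]}).
Hypothesis hp : p \in [pchar {mpoly k[n]}].

Local Notation A := {mpoly k[n]}.
Local Notation S := {mpoly {mpoly k[n]}[c * r]}.
Local Notation I := (ideal_gen (range f)).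
Local Notation g := (@generic_comb k n r f c).

Lemma eq_mxvec_index (i i' : 'I_c) (j j' : 'I_r) :
  (mxvec_index i j == mxvec_index i' j') = (i == i') && (j == j').
Proof.
apply/eqP/andP => [|[/eqP-> /eqP->] //].
case: (curry_mxvec_bij c r) => h hK _.
move=> /(congr1 h); rewrite -[mxvec_index i j]/(uncurry _ (i, j)).
by rewrite -[mxvec_index i' j']/(uncurry _ (i', j')) !hK // => -[-> ->].
Qed.

Lemma deriv_generic_comb i i0 j0 :
  (g i)^`M(mxvec_index i0 j0) = ((i == i0)%:R * f j0)%:MP.
Proof.
rewrite /generic_comb raddf_sum /=.
have term j : ('X_(mxvec_index i j) * (f j)%:MP : S)^`M(mxvec_index i0 j0)
    = (((i == i0) && (j == j0))%:R * f j)%:MP.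
  rewrite mderivM mderivC mulr0 addr0 mderivX mnm1E eq_mxvec_index.
  case: andP => [[/eqP-> /eqP->]|_]; last by rewrite scale0r !mul0r mpolyC0.
  rewrite scale1r mul1r (_ : _ - _ = 0)%MM ?mpolyX0 ?mul1r //.
  by apply/mnmP => l; rewrite mnmBE subnn mnm0E.
rewrite (eq_bigr _ (fun j _ => term j)) (bigD1 j0) //= eqxx andbT.
by rewrite big1 ?addr0 // => j /negPf ->; rewrite andbF mul0r mpolyC0.
Qed.

Lemma derivX (x : S) v d : (x ^+ d)^`M(v) = d%:R * x ^+ d.-1 * x^`M(v).
Proof.
elim: d => [|d IHd]; first by rewrite expr0 -mpolyC1 mderivC !mul0r.
rewrite exprS mderivM IHd; case: d {IHd} => [|d] /=.
  by rewrite expr0 !mul0r mulr0 addr0 !mulr1 mul1r.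
by rewrite exprS [in RHS]mulrS; ring.
Qed.

(** The variable [u_ij] occurs in [g_i] only, with coefficient [f_j]. *)
Lemma deriv_prod_generic_comb (d : 'I_c -> nat) i0 j0 :
  (\prod_i g i ^+ d i)^`M(mxvec_index i0 j0)
    = ((d i0)%:R * f j0) *: \prod_i g i ^+ (d i - (i == i0))%N.
Proof.
set v := mxvec_index i0 j0.
rewrite (bigD1 i0) //= mderivM derivX deriv_generic_comb eqxx mul1r.
have -> : (\prod_(i | i != i0) g i ^+ d i)^`M(v) = 0.
  apply: (big_ind (fun x : S => x^`M(v) = 0)).
  - by rewrite -mpolyC1 mderivC.
  - by move=> x y x0 y0; rewrite mderivM x0 y0 mul0r mulr0 addr0.
  move=> i /negPf i_neq; rewrite derivX deriv_generic_comb i_neq mul0r.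
  by rewrite mpolyC0 mulr0.
rewrite mulr0 addr0 [in RHS](bigD1 i0) //= eqxx subn1.
rewrite -mul_mpolyC mpolyCM mpolyC_nat.
rewrite [in RHS](eq_bigr (fun i => g i ^+ d i)) => [|i /negPf ->].
  by ring.
by rewrite subn0.
Qed.

Lemma deg_in_generic_comb i i0 j0 :
  deg_in_le (mxvec_index i0 j0) (i == i0) (g i).
Proof.
apply: deg_in_le_sum => j; rewrite -[X in deg_in_le _ X]addn0.
apply: deg_in_leM (@deg_in_leC _ _ _ _) => m; rewrite msuppX inE => /eqP->.
by rewrite mnm1E eq_mxvec_index; case: (i == i0) => //=; case: (j == j0).
Qed.

Lemma deg_in_prod_generic_comb v : deg_in_le v 1 (\prod_(i < c) g i).
Proof.
case/mxvec_indexP: v => i0 j0.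
apply: deg_in_leW (deg_in_le_prod (fun i => @deg_in_generic_comb i i0 j0)).
by rewrite (bigD1 i0) //= eqxx big1 // => i /negPf->.
Qed.

(** Induction on the total degree: the derivative of [prod_i g_i^d_i] with respect
to a variable [u_ij] with [d_i > 0] is [d_i f_j] times a product of total degree
one less, and [d_i] is invertible because [0 < d_i < p]. *)
Lemma ideal_pow_sub_content_prod s (d : 'I_c -> nat) :
  (forall i, (d i < p)%N) -> (\sum_i d i)%N = s ->
  ideal_pow I s `<=` content (\prod_i g i ^+ d i).
Proof.
elim: s d => [|s IHs] d ltd sumd.
  rewrite big1 ?content1 // => i _.
  by move/eqP: sumd; rewrite sum_nat_eq0 => /forallP/(_ i)/eqP->.
set G := \prod_i _; have Gid := contentP G.
have [i0 d_gt0] : exists i0, (0 < d i0)%N.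
  apply/existsP; apply: contra_eqT sumd => /existsPn d0.
  by rewrite big1 // => i _; apply/eqP; rewrite -leqn0 leqNgt; apply: d0.
have [|a ad] := @natr_unit_pchar A p (d i0) hp; first by rewrite d_gt0 ltd.
have IHd : ideal_pow I s `<=` content (\prod_i g i ^+ (d i - (i == i0))%N).
  apply: IHs => [i|]; first exact: leq_ltn_trans (leq_subr _ _) (ltd i).
  rewrite (bigD1 i0) //= eqxx; apply: (@addIn 1).
  rewrite [RHS]addn1 -sumd [RHS](bigD1 i0) //= addnAC subnK //; congr (_ + _)%N.
  by apply: eq_bigr => i /negPf->; rewrite subn0.
apply: ideal_mul_sub => // x y Ix sy.
suff: I `<=` ideal_colon (content G) (ideal_pow I s) by apply.
apply: ideal_gen_sub (ideal_colonP _ Gid) _ => _ [j _ <-] {x Ix y sy} y /IHd yd.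
have -> : f j * y = a * ((d i0)%:R * f j * y) by rewrite !mulrA ad mul1r.
have [_ _ GM] := Gid; apply: GM.
(* Without its unit factor [a], the element lies in the coefficient ideal of
   the derivative of [G] with respect to [u_(i0, j)]. *)
apply: (@content_deriv_sub _ _ (mxvec_index i0 j)).
by rewrite deriv_prod_generic_comb; apply: mem_contentZ.
Qed.

Lemma frob_nat_sub_content_prod m :
  frob_nat p (ideal_pow I c) m `<=` content ((\prod_(i < c) g i) ^+ m).
Proof.
apply: (frob_nat_sub_content hp) => [v|d ltd].
  exact: deg_in_prod_generic_comb.
apply: subset_trans (@ideal_powM_sub _ _ _ _) _.
rewrite -prodrXl; apply: (@ideal_pow_sub_content_prod _ (fun=> d)) => //.
by rewrite sum_nat_const card_ord.
Qed.

Lemma generic_ci_sub_ext : generic_ci f c `<=` @extended_ideal k n r f c.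
Proof.
have Eid : is_ideal (@extended_ideal k n r f c) by exact: ideal_genP.
apply: ideal_gen_sub => // _ [i _ <-]; apply: ideal_sum => // j _.
have [_ _ EM] := Eid; apply: EM; apply: mem_ideal_gen; exists (f j) => //.
by apply: mem_ideal_gen; exists j.
Qed.

(** Each [g_i] vanishes when the [u_ij] are set to 0. *)
Lemma generic_ci_mcoeff0 x : generic_ci f c x -> x@_0%MM = 0.
Proof.
suff: generic_ci f c `<=` [set x | x@_0%MM = 0] by apply.
apply: ideal_gen_sub => [|_ [i _ <-] /=].
  split=> [|y z /= y0 z0|a y /= y0]; first exact: mcoeff0.
    by rewrite mcoeffD y0 z0 addr0.
  by rewrite rmorphM /= y0 mulr0.
rewrite /generic_comb raddf_sum /= big1 // => j _; rewrite rmorphM /= mcoeffX.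
by rewrite mnm1_eq0 mul0r.
Qed.

(** If [1] were in [J], then [I S <= L], and elements of [I] would be
constant polynomials in [u] with constant term 0. *)
Lemma generic_linkage_proper : I <> [set 0] -> ~ generic_linkage f c 1.
Proof.
move=> I0 J1; apply: I0; apply/seteqP; split=> [x Ix|_ ->]; last first.
  by have [] := ideal_genP (range f).
have := J1 x%:MP (mem_ideal_gen _); rewrite mul1r.
move=> /(_ _) /generic_ci_mcoeff0; rewrite mpolyCK; apply.
by exists x.
Qed.

Lemma generic_ci_sub_linkage : generic_ci f c `<=` generic_linkage f c.
Proof. by move=> x Lx y _; apply: ideal_mulr (ideal_genP _) _. Qed.

End GenericCombinations.

(** * Comparison of the least critical exponents *)

(** In a domain a nonzero ideal lies only in nonzero primes, and each of these
has the zero ideal below it. *)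
Lemma ideal_height_gt0 (T : idomainType) (I : set T) c :
  is_ideal I -> I <> [set 0] -> ideal_height I c -> (0 < c)%N.
Proof.
move=> [I0 _ _] In0 [[P [Pprime sIP [_ Pmax]]] _]; apply: Pmax.
have zero_prime : prime_ideal [set (0 : T)].
  split=> [||x y /= /eqP]; last 1 first.
  - by rewrite mulf_eq0 => /orP[] /eqP; [left | right].
  - split=> [//|x y -> ->|a x ->]; first by rewrite /= addr0.
    by rewrite /= mulr0.
  - by move=> /eqP; rewrite oner_eq0.
exists (fun i => if i is 0 then [set 0] else P); split=> // [[] //|[] // _].
split=> [x ->|sP0]; first by have [[]] := Pprime.
by apply: In0; apply/seteqP; split=> [x /sIP /sP0|_ ->].
Qed.

Section GenericLce.
Variables (k : fieldType) (p n r c : nat) (f : 'I_r -> {mpoly k[n]}).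
Hypothesis hk : perfect_of_char k p.

Local Notation A := {mpoly k[n]}.
Local Notation I := (ideal_gen (range f)).
Local Notation L := (generic_ci f c).

Let hp : p \in [pchar A] := pchar_mpoly n hk.1.

(** The Cartier map of [S] attached to a pair of remainders, one for [A] and one for
the [u_ij], sends [x] to the Cartier map of [A] applied to one coefficient
of [x].  These values lie in [b], hence in its contraction, and the
coefficient is recovered from them by its expansion over [q]-th powers. *)
Lemma frob_pow_contraction e (b : set {mpoly A[c * r]}) (x : {mpoly A[c * r]}) :
  is_ideal b -> (forall m i, m \in msupp x -> (m i < p ^ e)%N) ->
  frob_pow p b e x ->
  content x `<=` frob_pow p [set a : A | b a%:MP] e.
Proof.
move=> bid small bx; set q := (p ^ e)%N.
set b' := [set a : A | b a%:MP].
have [kappa kappaC kappaK] := perfect_root e hk.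
have b'id : is_ideal b' := preim_ideal (mpolyC (c * r) (R := A)) bid.
apply: content_sub (frob_powP _ _ _) _ => m.
have [mx|/memN_msupp_eq0->] := boolP (m \in msupp x); last first.
  by have [] := frob_powP p b' e.
have kappa_b' (alpha : {ffun 'I_n -> 'I_q}) :
    b' (mpoly_cartier kappa alpha x@_m).
  have kaC := mpoly_cartierP hk.1 kappaC alpha.
  pose beta : {ffun 'I_(c * r) -> 'I_q} :=
    [ffun i => Ordinal (small m i mx)].
  have -> : m = mnm_digit beta by apply/mnmP => i; rewrite mnm_digitE ffunE.
  rewrite /b' /= -(mpoly_cartier_small kaC beta small).
  exact: cartier_map_frob_pow (mpoly_cartierP hp kaC beta) bid bx.
rewrite (mpoly_cartier_sum hk.1 kappaC kappaK x@_m).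
apply: ideal_sum (frob_powP _ _ _) _ => alpha _.
by apply: ideal_mulr (frob_powP _ _ _) _; apply: mem_frob_pow.
Qed.

(** The single element [(g_1 ... g_c)^m] of [(L^c)^[m]] already forces every ideal
[b] of the defining intersection to be the unit ideal. *)
Lemma frob_frac_generic_ci m e : (m < p ^ e)%N ->
  frob_frac p (ideal_pow I c) m e = setT ->
  frob_frac p (ideal_pow L c) m e = setT.
Proof.
move=> lt_m /frob_root_eqT rI; apply/frob_root_eqT => b bid sLb.
pose G := \prod_(i < c) generic_comb f i.
have bG : frob_pow p b e (G ^+ m).
  apply: sLb; apply: (mem_frob_nat (pchar_mpoly (c * r) hp)).
  by apply: mem_ideal_pow_prod => i; apply: mem_ideal_gen; exists i.
have small l i : l \in msupp (G ^+ m) -> (l i < p ^ e)%N.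
  move=> lG; apply: leq_ltn_trans lt_m; rewrite -[m]mul1n.
  exact: deg_in_leX (@deg_in_prod_generic_comb _ _ _ _ f i) _ lG.
apply: (rI [set a : A | b a%:MP]).
  exact: (preim_ideal (mpolyC (c * r) (R := A)) bid).
apply: subset_trans (frob_pow_contraction bid small bG).
exact: frob_nat_sub_content_prod.
Qed.

Lemma generic_ci_frob_frac m e :
  frob_frac p (ideal_pow L c) m e = setT ->
  frob_frac p (ideal_pow I c) m e = setT.
Proof.
pose phi : {rmorphism A -> {mpoly A[c * r]}} := mpolyC (c * r) (R := A).
pose rho : {rmorphism {mpoly A[c * r]} -> A} := mcoeff 0%MM.
have phiK : cancel phi rho by apply: mpolyCK.
move=> rL; apply: (frob_frac_ext_eqT hp phiK).
apply: frob_fracS rL; apply: subset_trans _ (@ideal_ext_pow_sub _ _ phi _ _).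
exact: ideal_powS (@generic_ci_sub_ext _ _ _ _ f).
Qed.

Lemma lce_generic_ci (R : realType) : (0 < c)%N -> ~ I 1 ->
  lce p R (ideal_pow I c) = lce p R (ideal_pow L c).
Proof.
move=> c_gt0 I1; congr sup; apply/seteqP.
split=> t [t_gt0 /frob_real_eqT[e re]]; split=> //; apply/frob_real_eqT.
  exists e; apply: frob_frac_generic_ci (re).
  apply: (frob_frac_eqT_lt hp (ideal_powP _ _) _ re) => Ic1.
  exact: I1 (ideal_pow_le1 (ideal_genP _) c_gt0 Ic1).
by exists e; apply: generic_ci_frob_frac.
Qed.

End GenericLce.

Theorem theorem1p3 (R : realType) (k : fieldType) (p : nat)
    (hk : perfect_of_char k p) (n r c : nat) (f : 'I_r -> {mpoly k[n]})
    (hI0 : ideal_gen (range f) <> [set 0])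
    (hIeq : equidimensional (ideal_gen (range f)))
    (hIc : ideal_height (ideal_gen (range f)) c) :
  lce p R (ideal_pow (ideal_gen (range f)) c)
    = lce p R (ideal_pow (generic_ci f c) c)
  /\ lce p R (ideal_pow (generic_ci f c) c)
    <= lce p R (ideal_pow (generic_linkage f c) c).
Proof.
have c_gt0 : (0 < c)%N by apply: ideal_height_gt0 hIc => //; apply: ideal_genP.
have [I1 _] := hIeq; split; first exact: (lce_generic_ci hk R c_gt0 I1).
have hpS : p \in [pchar {mpoly {mpoly k[n]}[c * r]}].
  by do 2!apply: pchar_mpoly; exact: hk.1.
apply: (lce_le hpS) => [|J1|].
- exact: ideal_powP.
- apply: (generic_linkage_proper (c := c) hI0).
  by apply: ideal_pow_le1 J1 => //; apply/ideal_colonP/ideal_genP.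
- exact: ideal_powS (@generic_ci_sub_linkage _ _ _ _ f).
Qed.
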